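(* Let $(\mathbb{X},\oplus,\otimes,\mathbb{0},\mathbb{1})$ be a selective idempotent semifield, and let $\bm{A}\in\mathbb{X}^{m\times n}$ and $\bm{B}\in\mathbb{X}^{m\times k}$ be row-regular matrices. Let $\mathcal{A}_{1}$ (respectively $\mathcal{B}_{1}$) be the set of all row-monomial matrices obtained from $\bm{A}$ (respectively from $\bm{B}$) by keeping exactly one nonzero entry in each row unchanged and setting all other entries to $\mathbb{0}$. Consider the equation $\bm{A}\bm{x}=\bm{B}\bm{y}$ in the unknown vectors $\bm{x}\in\mathbb{X}^{n}$ and $\bm{y}\in\mathbb{X}^{k}$. (i) The equation has a regular solution (a pair of regular vectors $\bm{x},\bm{y}$ with $\bm{A}\bm{x}=\bm{B}\bm{y}$) if and only if there exist matrices $\bm{A}_{1}\in\mathcal{A}_{1}$ and $\bm{B}_{1}\in\mathcal{B}_{1}$ such that $$\operatorname{Tr}(\bm{A}\bm{A}_{1}^{-}\bm{B}\bm{B}_{1}^{-})=\mathbb{1}.\qquad(\ast)$$ (ii) All regular solutions are given in parametric form as follows: a pair of regular vectors $(\bm{x},\bm{y})$ is a solution of the equation if and only if there exist $\bm{A}_{1}\in\mathcal{A}_{1}$ and $\bm{B}_{1}\in\mathcal{B}_{1}$ satisfying $(\ast)$ and parameter vectors $\bm{u}\in\mathbb{X}^{n}$, $\bm{v}\in\mathbb{X}^{k}$ such that $$\bm{x}=(\bm{A}_{1}^{-}\bm{B}\bm{B}_{1}^{-}\bm{A})^{\ast}\bm{u}\oplus\bm{A}_{1}^{-}\bm{B}(\bm{B}_{1}^{-}\bm{A}\bm{A}_{1}^{-}\bm{B})^{\ast}\bm{v},$$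 $$\bm{y}=\bm{B}_{1}^{-}\bm{A}(\bm{A}_{1}^{-}\bm{B}\bm{B}_{1}^{-}\bm{A})^{\ast}\bm{u}\oplus(\bm{B}_{1}^{-}\bm{A}\bm{A}_{1}^{-}\bm{B})^{\ast}\bm{v}.$$ If no pair $\bm{A}_{1}\in\mathcal{A}_{1}$, $\bm{B}_{1}\in\mathcal{B}_{1}$ satisfies $(\ast)$, then the equation has no regular solutions.
   Context: Idempotent semifield: a set $\mathbb{X}$ with associative and commutative operations $\oplus$ and $\otimes$ having distinct neutral elements $\mathbb{0}$ and $\mathbb{1}$ respectively, such that $(\mathbb{X},\oplus,\mathbb{0})$ is an idempotent commutative monoid ($x\oplus x=x$), $(\mathbb{X}\setminus\{\mathbb{0}\},\otimes,\mathbb{1})$ is an Abelian group, and $\otimes$ distributes over $\oplus$ (so that $\mathbb{0}\otimes x=\mathbb{0}$). The sign $\otimes$ is omitted. The order is $x\leq y$ iff $x\oplus y=y$. The semifield is selective: $x\oplus y\in\{x,y\}$ for all $x,y$, so the order is total. Matrices and vectors: $\mathbb{X}^{m\times n}$ is the set of $m\times n$ matrices over $\mathbb{X}$, and $\mathbb{X}^{n}$ the set of column vectors with $n$ elements. Matrix addition, multiplication and scalar multiplication are the usual ones with $\oplus,\otimes$ replacing $+,\times$; inequalities are componentwise. ''Nonzero'' means different from $\mathbb{0}$. A vector is regular if it has no element equal to $\mathbb{0}$. A matrix is row-regular if none of its rows consists entirely of $\mathbb{0}$; it is row-monomial if it has exactly one nonzero entry in each row. $\bm{I}$ is the identity matrix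 ($\mathbb{1}$ on the diagonal, $\mathbb{0}$ elsewhere). Conjugate: for a nonzero matrix $\bm{M}=(m_{ij})\in\mathbb{X}^{m\times n}$, $\bm{M}^{-}=(m_{ij}^{-})\in\mathbb{X}^{n\times m}$ with $m_{ij}^{-}=m_{ji}^{-1}$ if $m_{ji}\neq\mathbb{0}$, and $m_{ij}^{-}=\mathbb{0}$ otherwise. For a square matrix $\bm{M}\in\mathbb{X}^{n\times n}$: $\bm{M}^{0}=\bm{I}$, $\bm{M}^{p}=\bm{M}\bm{M}^{p-1}$ for $p\geq 1$; $\operatorname{tr}\bm{M}=\bigoplus_{i=1}^{n}m_{ii}$; $\operatorname{Tr}(\bm{M})=\bigoplus_{i=1}^{n}\operatorname{tr}(\bm{M}^{i})$. The Kleene star is $\bm{M}^{\ast}=\bigoplus_{i\geq0}\bm{M}^{i}$, which, whenever $\operatorname{Tr}(\bm{M})\leq\mathbb{1}$, equals the finite sum $\bigoplus_{i=0}^{n-1}\bm{M}^{i}$ (Kleene stars are used only under this condition). *)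

(* Defs.v *)
From HB Require Import structures.
From mathcomp Require Import all_boot all_algebra.
From mathcomp Require Import boolp classical_sets.

Set Implicit Arguments.
Unset Strict Implicit.
Unset Printing Implicit Defensive.

Import GRing.Theory.
Local Open Scope ring_scope.

(* [+], [*], [0], [1] stand for the idempotent addition, the multiplication,
   and their neutral elements.  A comNzSemiRingType already provides
   distributivity, [0 * x = 0] and [1 != 0]; with inverses of nonzero elements
   this makes the nonzero elements an Abelian group.  The value of [sfinv] at
   [0] is unspecified and never used. *)
HB.mixin Record isIdemSemifield X of GRing.ComNzSemiRing X := {
  sfinv : X -> X;
  saddxx : forall x : X, x + x = x;
  smulVx : forall x : X, x != 0 -> sfinv x * x = 1
}.

#[short(type="idemSemifieldType")]
HB.structure Definition IdemSemifield :=
  { X of GRing.ComNzSemiRing X & isIdemSemifield X }.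

Definition selective (X : idemSemifieldType) : Prop :=
  forall x y : X, x + y = x \/ x + y = y.

Definition sle (X : idemSemifieldType) (x y : X) : Prop := x + y = y.

Definition mxle (X : idemSemifieldType) m n (M N : 'M[X]_(m, n)) : Prop :=
  forall i j, sle (M i j) (N i j).

Definition regular (X : idemSemifieldType) n (x : 'cV[X]_n) : Prop :=
  forall i, x i 0 != 0.

Definition row_regular (X : idemSemifieldType) m n (M : 'M[X]_(m, n)) : Prop :=
  forall i, exists j, M i j != 0.

Definition row_selection (X : idemSemifieldType) m n (M : 'M[X]_(m, n)) :
    set 'M[X]_(m, n) :=
  [set M1 | forall i, exists2 j, M i j != 0 &
     forall l, M1 i l = if l == j then M i l else 0].

Definition conjugate_mx (X : idemSemifieldType) m n (M : 'M[X]_(m, n)) :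
    'M[X]_(n, m) :=
  \matrix_(i, j) (if M j i == 0 then 0 else sfinv (M j i)).

Definition Trmx (X : idemSemifieldType) n (M : 'M[X]_n) : X :=
  \sum_(1 <= i < n.+1) \tr (M ^+ i).

(* The infinite sum of the powers of [M] is their least upper bound, which is
   unique when it exists. *)
Definition is_kleene_star (X : idemSemifieldType) n (M : 'M[X]_n) :
    set 'M[X]_n :=
  [set S | (forall i : nat, mxle (M ^+ i) S) /\
           (forall T, (forall i : nat, mxle (M ^+ i) T) -> mxle S T)].

(* Defaults to [0] when the least upper bound does not exist; this cannot
   happen when [Trmx M] is at most [1]. *)
Definition kleene_star (X : idemSemifieldType) n (M : 'M[X]_n) : 'M[X]_n :=
  xget 0 (is_kleene_star M).

(* Main.v *)
Require Import Defs.
From mathcomp Require Import all_boot all_algebra.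
From mathcomp Require Import boolp classical_sets.

Set Implicit Arguments.
Unset Strict Implicit.
Unset Printing Implicit Defensive.

Import GRing.Theory.
Local Open Scope ring_scope.

(** The two inequalities [I <= A *m A1^-] (for every selection [A1]) and
    [A1^- *m A *m x <= x] (for a selection attaining each row maximum of
    [A *m x]) carry the proof.  Put [P = A *m A1^- *m B *m B1^-].

    The first inequality gives [I <= P], so [Tr P] is at least [1], and the
    condition [Tr P = 1] just says that no cycle of [P] weighs more than [1].

    Necessity: let [A x = B y =: w] be a regular solution, and select in each
    row an entry attaining the maximum of [A x], resp. of [B y]
    ([selection_attaining]).  The second inequality then makes [P *m w <= w],
    hence [P ^+ p *m w <= w] for all [p]; as [w] is regular the diagonal entries
    of [P ^+ p] are at most [1] ([Trmx_le1]).  The same inequality shows that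
    [x] and [y] are fixed by the two Kleene stars, so that they are of the
    announced form with parameters [u = x] and [v = y]
    ([solution_parametrized]).

    Sufficiency: if [Tr P = 1], cutting cycles out of walks bounds the powers
    of [P] by a finite sum ([Trmx_powers_bounded]); since the matrices under
    the two stars are obtained from [P] by permuting its four factors
    cyclically, their powers are bounded as well ([powers_bounded_swap]), and
    the stars exist as finite sums.  With
    [M = A1^- *m B *m B1^- *m A] and [S] the star of [M],
    [A S <= (B B1^-) A S <= (A A1^-) (B B1^-) A S = A M S <= A S],
    so the terms in [u] on both sides of the equation agree
    ([star_absorb]).  The terms in [v] agree by exchanging the roles of [A]
    and [B].  The parameters with all entries [1] produce a regular
    solution. *)

(** * The order of an idempotent semifield and of its matrices *)

Section Order.
Variable X : idemSemifieldType.
Implicit Types x y z : X.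

Lemma sle_refl x : sle x x.
Proof. exact: saddxx. Qed.

Lemma sle_trans y x z : sle x y -> sle y z -> sle x z.
Proof. by rewrite /sle => xy yz; rewrite -yz addrA xy. Qed.

Lemma sle_anti x y : sle x y -> sle y x -> x = y.
Proof. by rewrite /sle => xy yx; rewrite -yx addrC xy. Qed.

Lemma sle0x x : sle 0 x.
Proof. exact: add0r. Qed.

Lemma slex0 x : sle x 0 -> x = 0.
Proof. by rewrite /sle addr0. Qed.

Lemma sle_mul x y x' y' : sle x y -> sle x' y' -> sle (x * x') (y * y').
Proof.
rewrite /sle => xy xy'; apply: (@sle_trans (y * x')); rewrite /sle.
  by rewrite -mulrDl xy.
by rewrite -mulrDr xy'.
Qed.

Lemma sle_add_lub x y z : sle x z -> sle y z -> sle (x + y) z.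
Proof. by rewrite /sle => xz yz; rewrite -addrA yz xz. Qed.

Lemma smulf_neq0 x y : x != 0 -> y != 0 -> x * y != 0.
Proof.
move=> x0 y0; apply: contra_neq y0 => xy0.
by rewrite -[y]mul1r -(smulVx _ x0) -mulrA xy0 mulr0.
Qed.

Lemma sle_sum_lub (I : Type) (r : seq I) (Q : pred I) (F : I -> X) z :
  (forall i, Q i -> sle (F i) z) -> sle (\sum_(i <- r | Q i) F i) z.
Proof.
move=> Fz; apply: (big_ind (fun s => sle s z)) => //; first exact: sle0x.
exact: (fun x y => @sle_add_lub x y z).
Qed.

Lemma sle_sum (I : eqType) (r : seq I) (F : I -> X) i :
  i \in r -> sle (F i) (\sum_(j <- r) F j).
Proof. by move=> ir; rewrite (big_rem i ir) /sle addrA saddxx. Qed.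

Lemma sle_sumT (I : finType) (F : I -> X) i : sle (F i) (\sum_j F j).
Proof. by apply: sle_sum; rewrite mem_index_enum. Qed.

Lemma sle_cancel_r x z : z != 0 -> sle (x * z) z -> sle x 1.
Proof.
move=> z0 /(sle_mul (sle_refl (sfinv z))).
by rewrite mulrCA smulVx // mulr1.
Qed.

Lemma selective_sum (I : finType) (F : I -> X) : selective X ->
  \sum_i F i = 0 \/ exists i, \sum_i F i = F i.
Proof.
move=> selX.
apply: (big_ind (fun s => s = 0 \/ exists i, s = F i)) => [|x y Kx Ky|i _].
- by left.
- by case: (selX x y) => ->.
- by right; exists i.
Qed.

End Order.

Section MatrixOrder.
Variable X : idemSemifieldType.

(** Reads the entrywise order as an equation between matrices, so that
    monotonicity of the product is distributivity. *)
Lemma mxleE m n (M N : 'M[X]_(m, n)) : mxle M N <-> M + N = N.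
Proof.
split=> [MN|MN i j]; first by apply/matrixP=> i j; rewrite mxE; exact: MN.
by rewrite /sle -[in RHS]MN mxE.
Qed.

Lemma mxle_refl m n (M : 'M[X]_(m, n)) : mxle M M.
Proof. by move=> i j; exact: sle_refl. Qed.

Lemma mxle_trans m n (N M L : 'M[X]_(m, n)) :
  mxle M N -> mxle N L -> mxle M L.
Proof. by move=> MN NL i j; apply: sle_trans (MN i j) (NL i j). Qed.

Lemma mxle_anti m n (M N : 'M[X]_(m, n)) : mxle M N -> mxle N M -> M = N.
Proof. by move=> MN NM; apply/matrixP => i j; apply: sle_anti. Qed.

Lemma mxle_addr m n (M N : 'M[X]_(m, n)) : mxle M (M + N).
Proof. by move=> i j; rewrite mxE /sle addrA saddxx. Qed.

Lemma mxle_mull m n p (L : 'M[X]_(m, n)) (M N : 'M[X]_(n, p)) :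
  mxle M N -> mxle (L *m M) (L *m N).
Proof. by move=> /mxleE MN; apply/mxleE; rewrite -mulmxDr MN. Qed.

Lemma mxle_mulr m n p (L : 'M[X]_(n, p)) (M N : 'M[X]_(m, n)) :
  mxle M N -> mxle (M *m L) (N *m L).
Proof. by move=> /mxleE MN; apply/mxleE; rewrite -mulmxDl MN. Qed.

Lemma mxle_ge1_mull m n (L : 'M[X]_m) (M : 'M[X]_(m, n)) :
  mxle 1%:M L -> mxle M (L *m M).
Proof. by move=> L1; rewrite -[X in mxle X _]mul1mx; exact: mxle_mulr. Qed.

Lemma mxle_sum_lub m n (I : Type) (r : seq I) (Q : pred I)
    (F : I -> 'M[X]_(m, n)) (N : 'M[X]_(m, n)) :
  (forall i, Q i -> mxle (F i) N) -> mxle (\sum_(i <- r | Q i) F i) N.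
Proof. by move=> FN i j; rewrite summxE; apply: sle_sum_lub => l /FN. Qed.

Lemma mxle_sumT m n (I : finType) (F : I -> 'M[X]_(m, n)) i :
  mxle (F i) (\sum_j F j).
Proof. by move=> a b; rewrite summxE; exact: (sle_sumT (fun j => F j a b)). Qed.

Lemma sle_mulmx_term m n p (M : 'M[X]_(m, n)) (N : 'M[X]_(n, p)) i l j :
  sle (M i l * N l j) ((M *m N) i j).
Proof. by rewrite mxE; exact: (sle_sumT (fun l => M i l * N l j)). Qed.

Lemma regular_mxle n (x y : 'cV[X]_n) : mxle x y -> regular x -> regular y.
Proof.
move=> xy rx i; apply: contra_neq (rx i) => y0.
by apply: slex0; rewrite -y0.
Qed.

Lemma regular_mulmx m n (M : 'M[X]_(m, n)) (x : 'cV[X]_n) :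
  row_regular M -> regular x -> regular (M *m x).
Proof.
move=> rM rx i; have [j Mij] := rM i.
apply: contra_neq (smulf_neq0 Mij (rx j)) => Mx0.
by apply: slex0; rewrite -Mx0; exact: sle_mulmx_term.
Qed.

Lemma pow_sub_fixpoint n (M : 'M[X]_n) (x : 'cV[X]_n) p :
  mxle (M *m x) x -> mxle (M ^+ p *m x) x.
Proof.
move=> Mx; elim: p => [|p IHp]; first by rewrite expr0 mul1mx; exact: mxle_refl.
rewrite exprSr -mulmxE -mulmxA; exact: mxle_trans (mxle_mull _ Mx) IHp.
Qed.

(** Entrywise, [M ^+ p *m x <= x] contains [(M ^+ p) i i * x i <= x i], and
    [x i] can be cancelled. *)
Lemma Trmx_le1 n (M : 'M[X]_n) (x : 'cV[X]_n) :
  regular x -> mxle (M *m x) x -> sle (Trmx M) 1.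
Proof.
move=> rx Mx; apply: sle_sum_lub => p _; apply: sle_sum_lub => i _.
apply: (sle_cancel_r (rx i)).
exact: sle_trans (sle_mulmx_term _ _ _ _ _) (pow_sub_fixpoint p Mx i 0).
Qed.

Lemma Trmx_ge1 n (M : 'M[X]_n) :
  (0 < n)%N -> mxle 1%:M M -> sle 1 (Trmx M).
Proof.
case: n M => // n M _ IM; rewrite /Trmx big_nat_recl // expr1.
apply: (@sle_trans _ (\tr M)); last by rewrite /sle addrA saddxx.
have := IM 0 0; rewrite mxE eqxx => /sle_trans; apply.
exact: (sle_sumT (fun i => M i i)).
Qed.

Lemma diag_pow_le1 n (M : 'M[X]_n) c i :
  sle (Trmx M) 1 -> (0 < c <= n)%N -> sle ((M ^+ c) i i) 1.
Proof.
move=> TM c_range; apply: sle_trans TM.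
apply: (@sle_trans _ (\tr (M ^+ c))); first exact: (sle_sumT (fun i => (M ^+ c) i i)).
by apply: (sle_sum (fun c => \tr (M ^+ c))); rewrite mem_index_iota ltnS.
Qed.

End MatrixOrder.

(** * Powers of matrices with small cycles *)

Section CycleRemoval.
Variables (X : idemSemifieldType) (n : nat) (M : 'M[X]_n).

Definition walk_weight (v : nat -> 'I_n) a b :=
  \prod_(a <= t < b) M (v t) (v t.+1).

Lemma walk_weight_le v a b : (a <= b)%N ->
  sle (walk_weight v a b) ((M ^+ (b - a)) (v a) (v b)).
Proof.
move=> /subnKC <-; rewrite addKn; elim: (b - a)%N => [|d IHd].
  by rewrite addn0 /walk_weight big_geq // expr0 mxE eqxx; exact: sle_refl.
rewrite addnS /walk_weight big_nat_recr ?leq_addr //= exprSr.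
apply: sle_trans (sle_mul IHd (sle_refl _)) _.
exact: sle_mulmx_term.
Qed.

(** Selectivity turns the sum over all walks into the weight of a single
    one. *)
Lemma walk_attains_pow p i j : selective X -> (M ^+ p) i j != 0 ->
  exists v, [/\ v 0%N = i, v p = j & (M ^+ p) i j = walk_weight v 0 p].
Proof.
move=> selX; elim: p j => [|p IHp] j.
  rewrite expr0 mxE; case: (eqVneq i j) => [-> _|_]; last by rewrite eqxx.
  by exists (fun=> j); split=> //; rewrite /walk_weight big_geq.
rewrite exprSr -mulmxE mxE.
case: (selective_sum (fun l => (M ^+ p) i l * M l j) selX) => [->|[l ->]].
  by rewrite eqxx.
move=> nz; have /IHp [v [v0 vp eqv]] : (M ^+ p) i l != 0.
  by apply: contraNneq nz => ->; rewrite mul0r.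
exists (fun t => if (t <= p)%N then v t else j); split; rewrite ?ltnn //.
rewrite /walk_weight big_nat_recr //= leqnn ltnn vp eqv; congr (_ * _).
by apply: eq_big_nat => t /andP[_ tp]; rewrite tp (ltnW tp).
Qed.

(** A walk of length [p >= n] repeats a vertex within its first [n] steps.  The
    closed part has length at most [n], so the trace condition bounds its
    weight by [1], and removing it leaves a walk with the same ends. *)
Lemma pow_remove_cycle p i j : selective X -> sle (Trmx M) 1 -> (n <= p)%N ->
  (M ^+ p) i j = 0 \/
  exists2 q, (q < p)%N & sle ((M ^+ p) i j) ((M ^+ q) i j).
Proof.
move=> selX TM np; case: (eqVneq ((M ^+ p) i j) 0) => [|nz]; [by left|right].
have [v [<- <- ->]] := walk_attains_pow selX nz.
have /injectivePn [a0 [b0 neq_ab eq_v]] : ~~ injectiveb (fun t : 'I_n.+1 => v t).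
  by apply/negP => /injectiveP /leq_card; rewrite !card_ord ltnn.
have [a [b [lt_ab le_bn vab]]] :
    exists a b, [/\ (a < b)%N, (b <= n)%N & v a = v b].
  case: (ltngtP a0 b0) neq_ab => [ab _|ba _|/val_inj ->]; last by rewrite eqxx.
  - by exists a0, b0; split=> //; rewrite -ltnS.
  - by exists b0, a0; split=> //; rewrite -ltnS.
have le_bp := leq_trans le_bn np; have le_ab := ltnW lt_ab.
exists (a + (p - b))%N.
  by rewrite -[ltnRHS](subnKC le_bp) ltn_add2r.
rewrite /walk_weight (big_cat_nat (n := b)) //= (big_cat_nat (n := a)) //=.
have cyc : sle (walk_weight v a b) 1.
  apply: sle_trans (walk_weight_le v le_ab) _; rewrite -vab.
  by apply: diag_pow_le1 => //; rewrite subn_gt0 lt_ab (leq_trans (leq_subr _ _)).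
have := sle_mul (sle_mul (walk_weight_le v (leq0n a)) cyc) (walk_weight_le v le_bp).
move=> /sle_trans; apply; rewrite mulr1 subn0 -vab exprD.
exact: sle_mulmx_term.
Qed.

End CycleRemoval.

(** * Kleene stars *)

Section KleeneStar.
Variable X : idemSemifieldType.

(** The number of terms is left free, unlike the classical bound by the dimension,
    so that the property passes from [F *m E] to [E *m F] when their sizes
    differ. *)
Definition powers_bounded n (M : 'M[X]_n) : Prop :=
  exists K, forall p, mxle (M ^+ p) (\sum_(i < K) M ^+ i).

Lemma Trmx_powers_bounded n (M : 'M[X]_n) :
  selective X -> sle (Trmx M) 1 -> powers_bounded M.
Proof.
move=> selX TM; exists n => p i j; elim/ltn_ind: p => p IHp.
have [lt_pn|le_np] := ltnP p n.
  exact: (mxle_sumT (fun l : 'I_n => M ^+ l) (Ordinal lt_pn)).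
have [->|[q lt_qp /sle_trans]] := pow_remove_cycle i j selX TM le_np.
  exact: sle0x.
by apply; exact: IHp.
Qed.

Lemma mulmx_pow_swap m n (E : 'M[X]_(n, m)) (F : 'M[X]_(m, n)) p :
  (E *m F) ^+ p.+1 = E *m (F *m E) ^+ p *m F.
Proof.
elim: p => [|p IHp]; first by rewrite expr0 mulmx1.
by rewrite exprS IHp [(F *m E) ^+ p.+1]exprS -!mulmxE !mulmxA.
Qed.

(** [(E F)^(p+1) = E (F E)^p F], so one more term than for [F *m E] is
    enough. *)
Lemma powers_bounded_swap m n (E : 'M[X]_(n, m)) (F : 'M[X]_(m, n)) :
  powers_bounded (F *m E) -> powers_bounded (E *m F).
Proof.
case=> K FE; exists K.+1; case=> [|p].
  exact: (mxle_sumT (fun i : 'I_K.+1 => (E *m F) ^+ i) ord0).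
rewrite mulmx_pow_swap.
apply: (mxle_trans (mxle_mulr F (mxle_mull E (FE p)))).
rewrite mulmx_sumr mulmx_suml; apply: mxle_sum_lub => i _.
rewrite -mulmx_pow_swap -lift0.
exact: (mxle_sumT (fun i : 'I_K.+1 => (E *m F) ^+ i)).
Qed.

(** Once the powers are bounded by a finite partial sum, that sum is their least
    upper bound. *)
Lemma kleene_starE n (M : 'M[X]_n) K :
  (forall p, mxle (M ^+ p) (\sum_(i < K) M ^+ i)) ->
  kleene_star M = \sum_(i < K) M ^+ i.
Proof.
move=> MK; have starK : is_kleene_star M (\sum_(i < K) M ^+ i).
  by split=> // T MT; apply: mxle_sum_lub.
rewrite /kleene_star; case: xgetP => [S _ [MS minS]|/(_ _ starK)//].
by apply: mxle_anti; [exact: minS | exact: starK.2].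
Qed.

Lemma kleene_star_ge1 n (M : 'M[X]_n) :
  powers_bounded M -> mxle 1%:M (kleene_star M).
Proof. by case=> K MK; rewrite (kleene_starE MK); exact: (MK 0%N). Qed.

Lemma mul_kleene_star_le n (M : 'M[X]_n) :
  powers_bounded M -> mxle (M *m kleene_star M) (kleene_star M).
Proof.
case=> K MK; rewrite (kleene_starE MK) mulmx_sumr.
by apply: mxle_sum_lub => i _; rewrite mulmxE -exprS.
Qed.

Lemma kleene_star_fix n (M : 'M[X]_n) (x : 'cV[X]_n) :
  powers_bounded M -> mxle (M *m x) x -> kleene_star M *m x = x.
Proof.
move=> bM Mx; apply: mxle_anti; last first.
  exact: mxle_ge1_mull (kleene_star_ge1 bM).
case: bM => K MK; rewrite (kleene_starE MK) mulmx_suml.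
by apply: mxle_sum_lub => i _; exact: pow_sub_fixpoint.
Qed.

End KleeneStar.

(** * Row selections and their conjugates *)

Section Selection.
Variable X : idemSemifieldType.

(** The entry kept in row [i] meets its own inverse on the diagonal. *)
Lemma selection_ge1 m n (A A1 : 'M[X]_(m, n)) :
  row_selection A A1 -> mxle 1%:M (A *m conjugate_mx A1).
Proof.
move=> selA i i'; rewrite mxE; case: eqVneq => [<-|_]; last exact: sle0x.
have [j Aij A1i] := selA i.
apply: sle_trans (sle_mulmx_term _ _ _ j _).
by rewrite mxE A1i eqxx (negbTE Aij) mulrC smulVx //; exact: sle_refl.
Qed.

(** Keep in each row an entry [A i (f i)] with [A i (f i) * x (f i)] equal to
    the row sum [(A *m x) i]; multiplying by the inverse of [A i (f i)] gives back
    [x (f i)] exactly, and coordinates outside the image of [f] receive [0]. *)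
Lemma selection_attaining m n (A : 'M[X]_(m, n)) (x : 'cV[X]_n) :
  selective X -> row_regular A -> regular x ->
  exists2 A1, row_selection A A1 & mxle (conjugate_mx A1 *m (A *m x)) x.
Proof.
move=> selX rA rx.
have /fin_all_exists [f fP] i : exists j, (A *m x) i 0 = A i j * x j 0.
  have := regular_mulmx rA rx i; rewrite mxE.
  case: (selective_sum (fun j => A i j * x j 0) selX) => [->|[j ->] _].
    by rewrite eqxx.
  by exists j.
have Af i : A i (f i) != 0.
  by apply: contraNneq (regular_mulmx rA rx i); rewrite fP => ->; rewrite mul0r.
exists (\matrix_(i, l) if l == f i then A i l else 0).
  by move=> i; exists (f i) => // l; rewrite mxE.
move=> j z; rewrite (ord1 z) mxE; apply: sle_sum_lub => i _; rewrite fP !mxE.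
case: (eqVneq j (f i)) => [->|_]; last by rewrite eqxx mul0r; exact: sle0x.
by rewrite (negbTE (Af i)) mulrA smulVx // mul1r; exact: sle_refl.
Qed.

End Selection.

(** * The two-sided equation *)

(** [A *m S] is squeezed: the factors [B *m B1^-] and then [A *m A1^-] can only
    increase it, and both together turn it into [A *m (M *m S)], which is below
    [A *m S]. *)
Lemma star_absorb (X : idemSemifieldType) m n k
    (A A1 : 'M[X]_(m, n)) (B B1 : 'M[X]_(m, k)) :
  let M := conjugate_mx A1 *m B *m conjugate_mx B1 *m A in
  row_selection A A1 -> row_selection B B1 -> powers_bounded M ->
  A *m kleene_star M = B *m conjugate_mx B1 *m A *m kleene_star M.
Proof.
move=> M selA selB bM; apply: mxle_anti.
  by rewrite -(mulmxA (B *m _)); exact: mxle_ge1_mull (selection_ge1 selB).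
apply: mxle_trans (mxle_mull A (mul_kleene_star_le bM)).
have := mxle_ge1_mull (B *m conjugate_mx B1 *m A *m kleene_star M)
                      (selection_ge1 selA).
by rewrite !mulmxA.
Qed.

Section TwoSided.
Variables (X : idemSemifieldType) (m n k : nat).
Variables (A A1 : 'M[X]_(m, n)) (B B1 : 'M[X]_(m, k)).
Let A1' := conjugate_mx A1.
Let B1' := conjugate_mx B1.
Let P := A *m A1' *m B *m B1'.
Let S := kleene_star (A1' *m B *m B1' *m A).
Let T := kleene_star (B1' *m A *m A1' *m B).

(** The first matrix is [E *m A] where [P = A *m E], and the second is
    [(B1' *m A) *m (A1' *m B)], a swap of the first. *)
Lemma cyclic_powers_bounded : selective X -> Trmx P = 1 ->
  powers_bounded (A1' *m B *m B1' *m A) /\ powers_bounded (B1' *m A *m A1' *m B).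
Proof.
move=> selX TP.
have bM : powers_bounded (A1' *m B *m B1' *m A).
  apply: powers_bounded_swap; rewrite !mulmxA.
  by apply: Trmx_powers_bounded => //; rewrite TP; exact: sle_refl.
split=> //; rewrite -(mulmxA (B1' *m A)); apply: powers_bounded_swap.
by rewrite !mulmxA.
Qed.

Lemma parametric_solution (u : 'cV[X]_n) (v : 'cV[X]_k) :
  selective X -> row_selection A A1 -> row_selection B B1 -> Trmx P = 1 ->
  A *m (S *m u + A1' *m B *m T *m v) = B *m (B1' *m A *m S *m u + T *m v).
Proof.
move=> selX selA selB TP; have [bM bN] := cyclic_powers_bounded selX TP.
by rewrite !mulmxDr !mulmxA (star_absorb selA selB bM) -(star_absorb selB selA bN).
Qed.

(** The parameters are [x] and [y] themselves: the two inequalities, chained,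
    make the stars fix [x] and [y], and taken separately they absorb the cross
    terms [A1' *m B *m y] and [B1' *m A *m x]. *)
Lemma solution_parametrized (x : 'cV[X]_n) (y : 'cV[X]_k) :
  selective X -> Trmx P = 1 ->
  mxle (A1' *m (B *m y)) x -> mxle (B1' *m (A *m x)) y ->
  x = S *m x + A1' *m B *m T *m y /\ y = B1' *m A *m S *m x + T *m y.
Proof.
move=> selX TP leA leB; have [bM bN] := cyclic_powers_bounded selX TP.
have Sx : S *m x = x.
  apply: kleene_star_fix => //; rewrite -!mulmxA.
  by apply: mxle_trans leA; do 2!apply: mxle_mull.
have Ty : T *m y = y.
  apply: kleene_star_fix => //; rewrite -!mulmxA.
  by apply: mxle_trans leB; do 2!apply: mxle_mull.
rewrite -(mulmxA _ S) -(mulmxA _ T) Sx Ty -!mulmxA; split; symmetry.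
  by rewrite addrC; apply/mxleE.
exact/mxleE.
Qed.

End TwoSided.

(** Selections attaining the row maxima of [A *m x] and [B *m y] make the common
    value [w] of both sides satisfy [P *m w <= w]; the last two inequalities are
    what [solution_parametrized] asks for. *)
Lemma solution_selections (X : idemSemifieldType) (m n k : nat)
    (A : 'M[X]_(m, n)) (B : 'M[X]_(m, k)) (x : 'cV[X]_n) (y : 'cV[X]_k) :
  selective X -> (0 < m)%N -> row_regular A -> row_regular B ->
  regular x -> regular y -> A *m x = B *m y ->
  exists A1 B1, [/\ row_selection A A1, row_selection B B1,
    Trmx (A *m conjugate_mx A1 *m B *m conjugate_mx B1) = 1,
    mxle (conjugate_mx A1 *m (B *m y)) x &
    mxle (conjugate_mx B1 *m (A *m x)) y].
Proof.
move=> selX m0 rA rB rx ry eqAB.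
have [A1 selA leA] := selection_attaining selX rA rx.
have [B1 selB leB] := selection_attaining selX rB ry.
exists A1, B1; split=> //; [|by rewrite -eqAB|by rewrite eqAB].
apply: sle_anti.
  apply: (Trmx_le1 (regular_mulmx rA rx)); rewrite -!mulmxA.
  apply: mxle_mull; apply: mxle_trans leA; apply: mxle_mull.
  by rewrite eqAB; apply: mxle_mull.
apply: Trmx_ge1 => //; rewrite -(mulmxA _ B).
apply: mxle_trans (selection_ge1 selA) _.
rewrite -[X in mxle X _]mulmx1; apply: mxle_mull; exact: selection_ge1.
Qed.

Theorem theorem4 (X : idemSemifieldType) (m n k : nat)
    (A : 'M[X]_(m, n)) (B : 'M[X]_(m, k))
    (selX : selective X) (m_gt0 : (0 < m)%N)
    (regA : row_regular A) (regB : row_regular B) :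
  [/\ (* existence of a regular solution *)
      (exists (x : 'cV[X]_n) (y : 'cV[X]_k),
         [/\ regular x, regular y & A *m x = B *m y]) <->
      (exists (A1 : 'M[X]_(m, n)) (B1 : 'M[X]_(m, k)),
         [/\ row_selection A A1, row_selection B B1 &
             Trmx (A *m conjugate_mx A1 *m B *m conjugate_mx B1) = 1]),
      (* parametric description of all regular solutions *)
      (forall (x : 'cV[X]_n) (y : 'cV[X]_k), regular x -> regular y ->
         (A *m x = B *m y <->
          exists (A1 : 'M[X]_(m, n)) (B1 : 'M[X]_(m, k)),
            [/\ row_selection A A1, row_selection B B1,
                Trmx (A *m conjugate_mx A1 *m B *m conjugate_mx B1) = 1 &
                exists (u : 'cV[X]_n) (v : 'cV[X]_k),
                  x = kleene_star (conjugate_mx A1 *m B *m conjugate_mx B1 *m A) *m u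
                      + conjugate_mx A1 *m B
                        *m kleene_star (conjugate_mx B1 *m A *m conjugate_mx A1 *m B) *m v
                  /\
                  y = conjugate_mx B1 *m A
                        *m kleene_star (conjugate_mx A1 *m B *m conjugate_mx B1 *m A) *m u
                      + kleene_star (conjugate_mx B1 *m A *m conjugate_mx A1 *m B) *m v])) &
      (* no regular solution when the trace condition always fails *)
      ((~ exists (A1 : 'M[X]_(m, n)) (B1 : 'M[X]_(m, k)),
            [/\ row_selection A A1, row_selection B B1 &
                Trmx (A *m conjugate_mx A1 *m B *m conjugate_mx B1) = 1]) ->
       ~ exists (x : 'cV[X]_n) (y : 'cV[X]_k),
           [/\ regular x, regular y & A *m x = B *m y])].
Proof.
have exist : (exists (x : 'cV[X]_n) (y : 'cV[X]_k),
         [/\ regular x, regular y & A *m x = B *m y]) <->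
      (exists (A1 : 'M[X]_(m, n)) (B1 : 'M[X]_(m, k)),
         [/\ row_selection A A1, row_selection B B1 &
             Trmx (A *m conjugate_mx A1 *m B *m conjugate_mx B1) = 1]).
  split=> [[x [y [rx ry eqAB]]]|[A1 [B1 [selA selB TP]]]].
    have [A1 [B1 [selA selB TP _ _]]] :=
      solution_selections selX m_gt0 regA regB rx ry eqAB.
    by exists A1, B1.
  have [bM bN] := cyclic_powers_bounded selX TP.
  have reg1 p : regular (const_mx 1 : 'cV[X]_p).
    by move=> i; rewrite mxE oner_neq0.
  (* Any regular parameters give a regular pair, since each star is at least
     the identity. *)
  do 2!eexists; split; last exact: (parametric_solution (const_mx 1)
                                      (const_mx 1) selX selA selB TP).
  - apply: regular_mxle (reg1 n); apply: (mxle_trans _ (mxle_addr _ _)).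
    exact: mxle_ge1_mull (kleene_star_ge1 bM).
  - apply: regular_mxle (reg1 k); rewrite addrC.
    apply: (mxle_trans _ (mxle_addr _ _)).
    exact: mxle_ge1_mull (kleene_star_ge1 bN).
split=> // [x y rx ry|nosel]; last by move=> /exist.
split=> [eqAB|[A1 [B1 [selA selB TP [u [v [-> ->]]]]]]]; last first.
  exact: parametric_solution.
have [A1 [B1 [selA selB TP leA leB]]] :=
  solution_selections selX m_gt0 regA regB rx ry eqAB.
exists A1, B1; split=> //; exists x, y.
exact: solution_parametrized.
Qed.
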